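(* There is an absolute constant $c>0$ such that the following hold, for matroids of every rank $k$. (i) There is an algorithm for the matroid secretary problem in the preemption model that achieves competitive ratio at least $c$. (ii) There is an algorithm for the matroid secretary problem with a shortlist of size at most $\eta(k)=k$ that achieves competitive ratio at least $c$.
   Context: Matroid secretary problem. The elements of a matroid $\mathcal{M}=(\mathcal{N},\mathcal{I})$ with $|\mathcal{N}|=n$ and rank $k=rk(\mathcal{M})$ each have a value $v(e)\ge 0$, and arrive one at a time in uniformly random order; $n$ and $k$ are known in advance, while elements and values are revealed upon arrival (independence of sets of arrived elements can be tested). For a set $S$ let $f(S)=\sum_{e\in S}v(e)$, and let $\mathrm{OPT}=\max_{S\in\mathcal{I}} f(S)$. The goal is to obtain an independent set of large total value. Algorithms may be randomized, and expectations are over the arrival order and the internal randomness. Preemption model: the algorithm maintains a set $S$ of currently selected elements that is always independent. When an element arrives, the algorithm irrevocably decides whether to add it to $S$, and elements added to $S$ earlier can be discarded later (discarded or rejected elements cannot be recovered). Its competitive ratio is at least $c$ if its final set $S$ satisfies $\mathbb{E}[f(S)]\ge c\cdot\mathrm{OPT}$ on every instance. Shortlist model: upon arrival of each element, the algorithm irrevocably decides whether to add it to a shortlist $A$, where at the end $|A|\le\eta(k)$ is required; the set $A$ need not be independent. After seeing the entire input an independent subset of $A$ is chosen. The competitive ratio is at least $c$ if $\mathbb{E}\big[\max_{S\subseteq A,\,S\in\mathcal{I}} f(S)\big]\ge c\cdot\mathrm{OPT}$ on every instance. *)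

(* Defs.v *)
From HB Require Import structures.
From mathcomp Require Import all_boot all_order all_algebra.
From mathcomp Require Import all_classical all_reals all_analysis.

Set Implicit Arguments.
Unset Strict Implicit.
Unset Printing Implicit Defensive.

Import Order.TTheory GRing.Theory Num.Theory.

Local Open Scope ring_scope.

Record matroid (T : finType) := Matroid {
  indep : {set {set T}};
  indep0 : finset.set0 \in indep;
  indep_sub : forall A B : {set T},
    A \subset B -> B \in indep -> A \in indep;
  indep_exchange : forall A B : {set T},
    A \in indep -> B \in indep -> (#|A| < #|B|)%N ->
    exists2 e, e \in B :\: A & e |: A \in indep }.

Definition rk (T : finType) (M : matroid T) : nat :=
  (\max_(A in indep M) #|A|)%N.

Definition weight (R : realType) (T : finType) (v : T -> R) (S : {set T}) : R :=
  \sum_(e in S) v e.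

(* The default value 0 of the maximum is harmless: the empty set is always
   admissible and has weight 0. *)
Definition best_in (R : realType) (T : finType) (M : matroid T) (v : T -> R)
    (A : {set T}) : R :=
  \big[Num.max/0]_(S in indep M | S \subset A) weight v S.

Definition OPT (R : realType) (T : finType) (M : matroid T) (v : T -> R) : R :=
  \big[Num.max/0]_(S in indep M) weight v S.

(* An algorithm knows an element only through its arrival position, a member of
   'I_n. An observation at time i is what positions 0, ..., i have revealed:
   their values (0 is a dummy at later positions) and which sets of positions
   <= i are independent. Since time i is known as well, the dummies carry no
   information, and the earlier observations can be recovered. *)
Record observation (R : realType) (n : nat) := Observation {
  obs_value : {ffun 'I_n -> R};
  obs_indep : {set {set 'I_n}} }.

Definition arrival_order (T : finType) := {ffun 'I_#|T| -> T}.

Definition arrival_orders (T : finType) : {set arrival_order T} :=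
  [set s : arrival_order T | injectiveb s].

Definition observe (R : realType) (T : finType) (M : matroid T) (v : T -> R)
    (s : arrival_order T) (i : 'I_#|T|) : observation R #|T| :=
  Observation
    [ffun j : 'I_#|T| => if (j <= i)%N then v (s j) else 0]
    [set B : {set 'I_#|T|} |
       (B \subset [set j : 'I_#|T| | (j <= i)%N]) && (s @: B \in indep M)].

(* A randomized online algorithm for n elements. The seed is drawn once,
   before the first arrival; given the seed, the time, the observation at that
   time and the set of positions currently selected, a decision in D is made. *)
Record online_algorithm (R : realType) (D : finType) (n : nat) :=
  OnlineAlgorithm {
    seed_disp : measure_display;
    seed : measurableType seed_disp;
    seed_law : probability seed R;
    decide : seed -> 'I_n -> observation R n -> {set 'I_n} -> D;
    decide_measurable : forall i o S d,
      measurable [set w | decide w i o S = d]%classic }.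

(* The positions selected after the first t arrivals (after all of them if
   n <= t), where update i S d is the result of taking decision d at time i
   when S is the current selection. *)
Definition selected (R : realType) (T : finType) (D : finType)
    (update : 'I_#|T| -> {set 'I_#|T|} -> D -> {set 'I_#|T|})
    (a : online_algorithm R D #|T|) (M : matroid T) (v : T -> R)
    (s : arrival_order T) (w : seed a) (t : nat) : {set 'I_#|T|} :=
  foldl (fun S i => update i S (decide w i (observe M v s i) S))
        finset.set0 (take t (enum 'I_#|T|)).

(* Preemption: the decision is a set K of positions to hold. Intersecting with
   i |: S allows the current arrival to be taken or rejected and earlier
   selections to be discarded, but nothing lost to be recovered. *)
Definition preemption_algorithm (R : realType) (n : nat) :=
  online_algorithm R {set 'I_n} n.

Definition hold (n : nat) (i : 'I_n) (S K : {set 'I_n}) : {set 'I_n} :=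
  K :&: (i |: S).

Definition held (R : realType) (T : finType) (a : preemption_algorithm R #|T|)
    (M : matroid T) (v : T -> R) (s : arrival_order T) (w : seed a) (t : nat) :
    {set T} :=
  s @: selected (@hold #|T|) M v s w t.

Definition shortlist_algorithm (R : realType) (n : nat) :=
  online_algorithm R bool n.

Definition enlist (n : nat) (i : 'I_n) (A : {set 'I_n}) (b : bool) :
    {set 'I_n} :=
  if b then i |: A else A.

Definition shortlist (R : realType) (T : finType)
    (a : shortlist_algorithm R #|T|) (M : matroid T) (v : T -> R)
    (s : arrival_order T) (w : seed a) (t : nat) : {set T} :=
  s @: selected (@enlist #|T|) M v s w t.

(* Expectation over a uniformly random arrival order and an independent seed. *)
Definition expected_payoff (R : realType) (T D : finType)
    (a : online_algorithm R D #|T|) (payoff : arrival_order T -> seed a -> R) :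
    \bar R :=
  ('E_(seed_law a)[fun w => ((#|arrival_orders T|%:R)^-1 *
                             \sum_(s in arrival_orders T) payoff s w)%R])%E.

(* In the predicates below, the algorithm is a family indexed by the number n
   of elements and the rank k, both of which it knows in advance. *)

Definition preemption_always_independent (R : realType)
    (alg : forall n k : nat, preemption_algorithm R n) : Prop :=
  forall (T : finType) (M : matroid T) (v : T -> R), (forall e, 0 <= v e) ->
  forall s, s \in arrival_orders T ->
  forall (w : seed (alg #|T| (rk M))) (t : nat), held M v s w t \in indep M.

Definition preemption_competitive (R : realType) (c : R)
    (alg : forall n k : nat, preemption_algorithm R n) : Prop :=
  forall (T : finType) (M : matroid T) (v : T -> R), (forall e, 0 <= v e) ->
  ((c * OPT M v)%:E <=
   @expected_payoff R T _ (alg #|T| (rk M))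
     (fun s w => weight v (held M v s w #|T|)))%E.

Definition shortlist_size_at_most (R : realType) (eta : nat -> nat)
    (alg : forall n k : nat, shortlist_algorithm R n) : Prop :=
  forall (T : finType) (M : matroid T) (v : T -> R), (forall e, 0 <= v e) ->
  forall s, s \in arrival_orders T ->
  forall w : seed (alg #|T| (rk M)),
    (#|shortlist M v s w #|T| | <= eta (rk M))%N.

Definition shortlist_competitive (R : realType) (c : R)
    (alg : forall n k : nat, shortlist_algorithm R n) : Prop :=
  forall (T : finType) (M : matroid T) (v : T -> R), (forall e, 0 <= v e) ->
  ((c * OPT M v)%:E <=
   @expected_payoff R T _ (alg #|T| (rk M))
     (fun s w => best_in M v (shortlist M v s w #|T|)))%E.

(* Main.v *)
Require Import Defs.
From HB Require Import structures.
From mathcomp Require Import all_boot all_order all_algebra.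
From mathcomp Require Import all_classical all_reals all_analysis.
From mathcomp Require Import fintype finset perm zify lra.

(* Order the elements by decreasing value, breaking ties by a key, and call an
   element of [X] greedy if the elements of [X] before it do not span it. The
   greedy set of [X] is a maximum-weight independent subset of [X], and an
   element that is greedy in [X] is greedy in every smaller set containing it.

   (i) Hence holding the greedy set of the elements that have arrived never
   requires recovering a lost element, and ends with the optimum itself.

   (ii) Observe the first [m ~ 2n/3] arrivals without selecting. Afterwards
   enlist an arrival [e] if it is improving, i.e. greedy in the sample together
   with [e], as long as the shortlist has room. Elements of the optimum are
   always improving, so such an element, if it arrives after the sample, is
   lost only when at least [k] other arrivals are improving. Among the [m + 1]
   positions formed by the sample and one later position [j], at most [k] are
   greedy, so by symmetry [j] is improving with probability at most
   [k / (m + 1)], even conditionally on where the given element is. By Markov's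
   inequality the loss has probability at most [(n - m - 1) / (m + 1) <= 1/2],
   which yields the ratio [1/3 * 1/2]. The symmetry would fail if ties were
   broken by arrival time, so the seed is a uniformly random permutation of the
   positions that breaks them. *)

Set Implicit Arguments.
Unset Strict Implicit.
Unset Printing Implicit Defensive.

Import Order.TTheory GRing.Theory Num.Theory.

Local Open Scope ring_scope.

(** * Greedy sets of a set family *)

(** Stated for a bare family because an observation supplies no matroid. For a matroid and [e]
    outside [Y] it says that [e] is not in the closure of [Y]. *)
Definition unspanned (T : finType) (F : {set {set T}}) (e : T) (Y : {set T}) :
    bool :=
  [forall I in F, (I \subset Y) ==> (e |: I \in F)].

Definition greedy (T : finType) (F : {set {set T}}) (lt : rel T)
    (X : {set T}) : {set T} :=
  [set e in X | unspanned F e [set b in X | lt b e]].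

Lemma unspannedS (T : finType) (F : {set {set T}}) (e : T) (Y Z : {set T}) :
  Y \subset Z -> unspanned F e Z -> unspanned F e Y.
Proof.
move=> YZ /forall_inP eZ; apply/forall_inP => I IF; apply/implyP => IY.
exact: (implyP (eZ I IF)) (subset_trans IY YZ).
Qed.

Lemma greedy_sub (T : finType) (F : {set {set T}}) (lt : rel T)
    (X : {set T}) : greedy F lt X \subset X.
Proof. by apply/subsetP => x; rewrite inE => /andP[]. Qed.

Lemma greedyS (T : finType) (F : {set {set T}}) (lt : rel T)
    (X Y : {set T}) : X \subset Y -> X :&: greedy F lt Y \subset greedy F lt X.
Proof.
move=> XY; apply/subsetP => x; rewrite !inE => /and3P[-> _].
by apply: unspannedS; apply/subsetP => b; rewrite !inE => /andP[/(subsetP XY)->].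
Qed.

(** Greediness is local to [X], so it can be computed from partial information. *)
Lemma eq_greedy (T : finType) (F F' : {set {set T}}) (lt lt' : rel T)
    (X : {set T}) :
  (forall B : {set T}, B \subset X -> (B \in F) = (B \in F')) ->
  {in X &, lt =2 lt'} -> greedy F lt X = greedy F' lt' X.
Proof.
move=> FF ltlt; apply/setP => e; rewrite !inE.
case: (boolP (e \in X)) => //= eX.
have -> : [set b in X | lt b e] = [set b in X | lt' b e].
  apply/setP => b; rewrite !inE.
  by case: (boolP (b \in X)) => //= bX; rewrite ltlt.
apply: eq_forallb => I; have [sI|] := boolP (I \subset _); last by rewrite !implybT.
have sX : I \subset X.
  by apply: subset_trans sI _; apply/subsetP => b; rewrite inE => /andP[].
by rewrite !FF // subUset sub1set eX.
Qed.

(** * Transport from elements to positions *)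

Definition pullback (S T : finType) (h : S -> T) (F : {set {set T}}) :
    {set {set S}} :=
  [set B : {set S} | h @: B \in F].

(** Image and preimage under [h] match the independent sets of predecessors on the two sides. *)
Lemma mem_greedy_pullback (S T : finType) (h : S -> T) (F : {set {set T}})
    (lt : rel T) (X : {set S}) (i : S) : injective h ->
  (i \in greedy (pullback h F) (relpre h lt) X) =
  (h i \in greedy F lt (h @: X)).
Proof.
move=> hI; rewrite !inE (mem_imset _ _ hI); congr (_ && _).
apply/forall_inP/forall_inP => H I IF; apply/implyP => /subsetP sI.
  have IE : I = h @: (h @^-1: I).
    apply/setP => y; apply/idP/imsetP => [yI|[x xI ->]]; last by rewrite inE in xI.
    have := sI _ yI; rewrite inE => /andP[/imsetP[x _ yx] _].
    by exists x; rewrite // inE -yx.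
  have := H (h @^-1: I); rewrite inE -IE => /(_ IF)/implyP.
  rewrite inE imsetU1 -IE; apply; apply/subsetP => x hxI; rewrite inE in hxI.
  by have := sI _ hxI; rewrite !inE (mem_imset _ _ hI).
have := H (h @: I); rewrite inE in IF; move=> /(_ IF)/implyP.
rewrite inE imsetU1; apply; apply/subsetP => y /imsetP[x xI ->].
by have := sI _ xI; rewrite !inE (mem_imset _ _ hI).
Qed.

Lemma pullback0 (S T : finType) (h : S -> T) (M : matroid T) :
  set0 \in pullback h (indep M).
Proof. by rewrite inE imset0 indep0. Qed.

Lemma pullback_sub (S T : finType) (h : S -> T) (M : matroid T)
    (A B : {set S}) :
  A \subset B -> B \in pullback h (indep M) -> A \in pullback h (indep M).
Proof. by move=> AB; rewrite !inE; apply: indep_sub; apply: imsetS. Qed.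

Lemma pullback_exchange (S T : finType) (h : S -> T) (M : matroid T)
    (A B : {set S}) : injective h ->
  A \in pullback h (indep M) -> B \in pullback h (indep M) ->
  (#|A| < #|B|)%N ->
  exists2 e, e \in B :\: A & e |: A \in pullback h (indep M).
Proof.
move=> hI; rewrite !inE => iA iB; rewrite -(card_imset A hI) -(card_imset B hI).
move=> /(indep_exchange iA iB)[y]; rewrite inE => /andP[yA /imsetP[x xB yx]] iyA.
exists x; rewrite inE ?imsetU1 -?yx // xB andbT.
by apply: contra yA; rewrite yx => /imset_f->.
Qed.

Definition pullback_matroid (S T : finType) (h : S -> T) (M : matroid T)
    (hI : injective h) : matroid S :=
  Matroid (pullback0 h M) (@pullback_sub S T h M)
    (fun A B => @pullback_exchange S T h M A B hI).

(** * Optimality of the greedy set *)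

Definition strict_total (T : finType) (lt : rel T) : Prop :=
  [/\ irreflexive lt, transitive lt & forall x y, x != y -> lt x y || lt y x].

Lemma strict_total_last (T : finType) (lt : rel T) (X : {set T}) (x0 : T) :
  strict_total lt -> x0 \in X ->
  exists2 e, e \in X & forall x, x \in X -> x != e -> lt x e.
Proof.
move=> [irr tr tot] x0X.
(* Take the element with the most predecessors: anything after it would have strictly more. *)
pose below x := #|[set b in X | lt b x]|.
case: (@arg_maxnP _ x0 (mem X) below x0X) => e eX emax.
exists e => // x xX /tot /orP[//|ltex].
have /= := emax x xX; rewrite leqNgt => /negP[]; apply: proper_card.
apply/properP; split.
  by apply/subsetP => b; rewrite !inE => /andP[->] /tr; apply.
by exists e; rewrite !inE ?irr ?ltex ?andbF ?andbT //; exact: eX.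
Qed.

(** A last element is nobody's predecessor, so the greedy set can be built one element at a time, as
    in Kruskal's algorithm. *)
Lemma greedy_setU1_last (T : finType) (F : {set {set T}}) (lt : rel T)
    (X : {set T}) (e : T) :
  strict_total lt -> e \notin X -> (forall x, x \in X -> lt x e) ->
  greedy F lt (e |: X) =
    if unspanned F e X then e |: greedy F lt X else greedy F lt X.
Proof.
move=> [irr tr tot] eX Xe.
have lte x : x \in X -> lt e x = false.
  by move=> /Xe ltxe; apply/negP => /(tr _ _ _ ltxe); rewrite irr.
have belowe : [set b in e |: X | lt b e] = X.
  apply/setP => b; rewrite !inE; have [->|_] /= := eqVneq b e.
    by rewrite irr (negbTE eX).
  by case: (boolP (b \in X)) => //= /Xe.
have below x : x \in X -> [set b in e |: X | lt b x] = [set b in X | lt b x].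
  move=> /lte ex; apply/setP => b; rewrite !inE.
  by have [->|] //= := eqVneq b e; rewrite ex andbF.
apply/setP => x; rewrite inE.
have [->|xe] := eqVneq x e.
  rewrite belowe setU11 /=; case: ifP => _; first by rewrite setU11.
  by symmetry; apply/negP => /(subsetP (greedy_sub _ _ _)); apply/negP.
have -> : (x \in (if unspanned F e X then e |: greedy F lt X else greedy F lt X))
    = (x \in greedy F lt X).
  by case: ifP => //; rewrite in_setU1 (negbTE xe).
rewrite in_setU1 (negbTE xe) inE /=.
by case: (boolP (x \in X)) => //= xX; rewrite below.
Qed.

(* A larger independent set in [e |: X] would, by exchange with [G], make
   [e |: G] independent; enlarging [I] by exchange with it avoids [e], hence
   contradicts the maximality of [G] in [X]. *)
Lemma spanned_card (T : finType) (M : matroid T) (X G : {set T}) (e : T) :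
  G \in indep M -> G \subset X ->
  (forall I, I \in indep M -> I \subset X -> (#|I| <= #|G|)%N) ->
  ~~ unspanned (indep M) e X ->
  forall I, I \in indep M -> I \subset e |: X -> (#|I| <= #|G|)%N.
Proof.
move=> iG GX Gmax; rewrite negb_forall_in => /exists_inP[I0 iI0].
rewrite negb_imply => /andP[I0X eI0] I iI IX; rewrite leqNgt; apply/negP => GI.
have [x] := indep_exchange iG iI GI; rewrite inE => /andP[xG xI] ixG.
have [xe|xe] := eqVneq x e; last first.
  have xX : x \in X by have := subsetP IX _ xI; rewrite in_setU1 (negbTE xe).
  have := Gmax _ ixG; rewrite subUset sub1set xX GX => /(_ isT).
  by rewrite cardsU1 xG add1n ltnn.
rewrite {x}xe in xG xI ixG.
pose P (J : {set T}) := [&& J \in indep M, I0 \subset J & J \subset X].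
have PI0 : P I0 by rewrite /P iI0 subxx.
case: (@arg_maxnP _ I0 P (fun J : {set T} => #|J|) PI0) => J /and3P[iJ I0J JX] Jmax.
have [|x] := indep_exchange iJ ixG.
  by rewrite cardsU1 xG add1n ltnS Gmax.
rewrite inE in_setU1 => /andP[xJ /orP[/eqP->|xG']] ixJ.
  by move/negP: eI0; apply; apply: indep_sub ixJ; apply: setUS.
have /= := Jmax (x |: J); rewrite /P ixJ subUset sub1set (subsetP GX _ xG') JX.
rewrite (subset_trans I0J) ?subsetUr //= => /(_ isT).
by rewrite cardsU1 xJ add1n ltnn.
Qed.

(** Induction on [#|X|], removing the last element [e], which has the least value. The cardinality
    bound is carried along because [spanned_card] needs it when [e] is spanned. *)
Lemma greedy_optimal (R : realType) (T : finType) (M : matroid T)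
    (lt : rel T) (v : T -> R) (X : {set T}) :
  strict_total lt -> (forall x y, lt x y -> v y <= v x) ->
  (forall x, 0 <= v x) ->
  greedy (indep M) lt X \in indep M /\
  (forall I : {set T}, I \in indep M -> I \subset X ->
    (#|I| <= #|greedy (indep M) lt X|)%N /\
    weight v I <= weight v (greedy (indep M) lt X)).
Proof.
move=> lto ltv v0; have [irr _ _] := lto.
have weightU1 x (A : {set T}) : x \notin A -> weight v (x |: A) = v x + weight v A.
  by move=> xA; rewrite /weight big_setU1.
elim: {X}#|X| {-2}X (erefl #|X|) => [|n IH] X.
  move/eqP; rewrite cards_eq0 => /eqP->.
  have -> : greedy (indep M) lt set0 = set0 by apply/setP => x; rewrite !inE.
  split=> [|I _]; first exact: indep0.
  by rewrite subset0 => /eqP->.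
move=> cX; have /set0Pn[x0 x0X] : X != set0 by rewrite -cards_eq0 cX.
have [e eX elast] := strict_total_last lto x0X.
have cX' : #|X :\ e| = n by move: cX; rewrite (cardsD1 e) eX add1n => -[].
have eX' : e \notin X :\ e by rewrite !inE eqxx.
have lte x : x \in X :\ e -> lt x e by rewrite !inE => /andP[xe /elast]; apply.
have XE : X = e |: X :\ e by rewrite setD1K.
have {IH} [] := IH _ cX'; move: (X :\ e) cX' eX' lte XE => X' _ eX' lte ->.
rewrite (greedy_setU1_last (indep M) lto eX' lte); set G := greedy _ _ X'.
move=> iG Gmax; have GX' : G \subset X' := greedy_sub _ _ _.
have eG : e \notin G by apply: contra eX'; exact: (subsetP GX').
have split_e (I : {set T}) : I \in indep M -> I \subset e |: X' ->
    (#|I :\ e| <= #|G|)%N /\ weight v (I :\ e) <= weight v G.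
  move=> iI IX; apply: Gmax; first exact: indep_sub (subsetDl _ _) iI.
  by rewrite subDset.
(* Nonnegativity of [v e] covers the case of [e] outside [I]. *)
have wI (I : {set T}) : weight v I <= v e + weight v (I :\ e).
  have [eI|eI] := boolP (e \in I); last first.
    by rewrite (setDidPl _) ?lerDr // disjoint_sym disjoints1.
  by rewrite -{1}(setD1K eI) weightU1 // !inE eqxx.
case: ifPn => [fe|sp]; split=> //.
- exact: (implyP (forall_inP fe _ iG)).
- move=> I iI IX; have [cI wIG] := split_e I iI IX; split.
    by rewrite cardsU1 eG (cardsD1 e I) leq_add // leq_b1.
  by rewrite weightU1 //; apply: le_trans (wI I) _; rewrite lerD2l.
have cardG := spanned_card iG GX' (fun I iI IX => (Gmax I iI IX).1) sp.
move=> I iI IX; split; first exact: cardG.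
have [eI|eI] := boolP (e \in I); last first.
  have IeE : I :\ e = I by apply/setDidPl; rewrite disjoint_sym disjoints1.
  by rewrite -IeE; apply: (split_e I iI IX).2.
have iIe : I :\ e \in indep M := indep_sub (subsetDl _ _) iI.
(* [I] without [e] is smaller than [G], so some [f] of [G] can replace [e]; it comes before [e] and
   is worth at least as much. *)
have [|f] := indep_exchange iIe iG.
  by have := cardG I iI IX; rewrite (cardsD1 e I) eI.
rewrite inE => /andP[fI fG] ifI.
have fX' := subsetP GX' _ fG.
have vef : v e <= v f by apply/ltv/lte.
apply: le_trans (wI I) _; apply: (@le_trans _ _ (weight v (f |: I :\ e))).
  by rewrite weightU1 // lerD2r.
apply: (Gmax _ ifI _).2.
by rewrite subUset sub1set fX' subDset.
Qed.

(** * The order by value and the greedy positions *)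

Definition before (R : realType) (T : finType) (v : T -> R) (key : T -> nat) :
    rel T :=
  fun x y => (v y < v x) || ((v x == v y) && (key x < key y)%N).

Lemma before_strict_total (R : realType) (T : finType) (v : T -> R)
    (key : T -> nat) : injective key -> strict_total (before v key).
Proof.
move=> keyI; split.
- by move=> x; rewrite /before ltxx ltnn andbF.
- move=> y x z; rewrite /before => /orP[xy|/andP[/eqP xy kxy]].
    move=> /orP[yz|/andP[/eqP <- _]]; last by rewrite xy.
    by rewrite (lt_trans yz xy).
  rewrite xy => /orP[->//|/andP[-> kyz]].
  by rewrite (ltn_trans kxy kyz) orbT.
- move=> x y xy; rewrite /before (eq_sym (v y)).
  case: (ltgtP (v x) (v y)) => //= _.
  by rewrite -neq_ltn; apply: contra xy => /eqP/keyI->.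
Qed.

Lemma before_val (R : realType) (T : finType) (v : T -> R) (key : T -> nat)
    (x y : T) : before v key x y -> v y <= v x.
Proof. by rewrite /before => /orP[/ltW//|/andP[/eqP-> _]]. Qed.

(** The pair [x] holds all the randomness: the arrival order and the tie-breaking permutation. *)
Definition position_greedy (R : realType) (T : finType) (M : matroid T)
    (v : T -> R) (x : arrival_order T * 'S_#|T|) (X : {set 'I_#|T|}) :
    {set 'I_#|T|} :=
  greedy (pullback x.1 (indep M)) (before (v \o x.1) (fun i => x.2 i)) X.

Lemma arrival_order_inj (T : finType) (s : arrival_order T) :
  s \in arrival_orders T -> injective s.
Proof. by rewrite inE => /injectiveP. Qed.

Lemma perm_key_inj (n : nat) (p : 'S_n) : injective (fun i => p i : nat).
Proof. by move=> i j /val_inj/perm_inj. Qed.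

Lemma position_greedy_indep (R : realType) (T : finType) (M : matroid T)
    (v : T -> R) (x : arrival_order T * 'S_#|T|) (X : {set 'I_#|T|}) :
  (forall e, 0 <= v e) -> x.1 \in arrival_orders T ->
  x.1 @: position_greedy M v x X \in indep M.
Proof.
move=> v0 /arrival_order_inj sI.
have [] := @greedy_optimal _ _ (pullback_matroid M sI) _ (v \o x.1) X
  (before_strict_total (v \o x.1) (@perm_key_inj _ x.2)) (@before_val _ _ _ _)
  (fun i => v0 _).
by rewrite inE.
Qed.

Lemma card_position_greedy (R : realType) (T : finType) (M : matroid T)
    (v : T -> R) (x : arrival_order T * 'S_#|T|) (X : {set 'I_#|T|}) :
  (forall e, 0 <= v e) -> x.1 \in arrival_orders T ->
  (#|position_greedy M v x X| <= rk M)%N.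
Proof.
move=> v0 xO; rewrite -(card_imset _ (arrival_order_inj xO)).
by apply: leq_bigmax_cond; apply: position_greedy_indep.
Qed.

Lemma OPT_le_position_greedy (R : realType) (T : finType) (M : matroid T)
    (v : T -> R) (x : arrival_order T * 'S_#|T|) :
  (forall e, 0 <= v e) -> x.1 \in arrival_orders T ->
  OPT M v <= \sum_(i in position_greedy M v x setT) v (x.1 i).
Proof.
move=> v0 /arrival_order_inj sI.
apply: bigmax_le => [|I iI]; first by apply: sumr_ge0.
have [_ opt] := @greedy_optimal _ _ (pullback_matroid M sI) _ (v \o x.1) setT
  (before_strict_total (v \o x.1) (@perm_key_inj _ x.2)) (@before_val _ _ _ _)
  (fun i => v0 _).
(* An injective arrival order is onto by counting, so every set of elements is the image of a set of
   positions. *)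
have IE : I = x.1 @: (x.1 @^-1: I).
  apply/setP => e; apply/idP/imsetP => [eI|[i + ->]]; last by rewrite inE.
  have /codomP[i ei] : e \in codom x.1 by apply: inj_card_onto; rewrite ?card_ord.
  by exists i; rewrite // inE -ei.
have [|_] := opt (x.1 @^-1: I) _ (subsetT _); first by rewrite inE -IE.
apply: le_trans; rewrite {1}/weight {1}IE big_imset //=.
by move=> ? ? _ _; apply: sI.
Qed.

(** * Symmetry under permuting positions *)

(** Order and keys are permuted together, so each element keeps its key and the ranking of the
    elements is unchanged. *)
Definition relabel (T : finType) (t : 'S_#|T|)
    (x : arrival_order T * 'S_#|T|) : arrival_order T * 'S_#|T| :=
  ([ffun i => x.1 (t i)], (t * x.2)%g).

Lemma mem_position_greedy_relabel (R : realType) (T : finType) (M : matroid T)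
    (v : T -> R) (t : 'S_#|T|) (x : arrival_order T * 'S_#|T|)
    (X : {set 'I_#|T|}) (i : 'I_#|T|) :
  (i \in position_greedy M v (relabel t x) X) =
  (t i \in position_greedy M v x (t @: X)).
Proof.
rewrite /position_greedy -(mem_greedy_pullback _ _ _ _ (@perm_inj _ t)).
suff -> : greedy (pullback (relabel t x).1 (indep M))
      (before (v \o (relabel t x).1) (fun i => (relabel t x).2 i)) X =
    greedy (pullback t (pullback x.1 (indep M)))
      (relpre t (before (v \o x.1) (fun i => x.2 i))) X by [].
apply: eq_greedy => [B _|a b _ _].
  have relE : (relabel t x).1 =1 x.1 \o t by move=> a; rewrite ffunE.
  by rewrite !inE -imset_comp (eq_imset _ relE).
by rewrite /before /= !ffunE !permM.
Qed.

(** Relabelling by [t] is inverted by relabelling by [t^-1]; this is the invariance of the uniform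
    law on pairs. *)
Lemma sum_relabel (R : realType) (T : finType) (t : 'S_#|T|)
    (F : arrival_order T * 'S_#|T| -> R) :
  \sum_(x | x.1 \in arrival_orders T) F x =
  \sum_(x | x.1 \in arrival_orders T) F (relabel t x).
Proof.
have relK : cancel (relabel t) (relabel t^-1).
  move=> [s p]; congr pair; last by rewrite /= mulKg.
  by apply/ffunP => i; rewrite !ffunE permKV.
rewrite (reindex_inj (can_inj relK)); apply: eq_bigl => -[s p].
rewrite !inE; apply/injectiveP/injectiveP => sI i j /= eij.
  apply: (@perm_inj _ t^-1); apply: sI; rewrite /= !ffunE !permKV //.
by move: eij; rewrite !ffunE => /sI/perm_inj.
Qed.

Definition greedy_value (R : realType) (T : finType) (M : matroid T)
    (v : T -> R) (i : 'I_#|T|) (x : arrival_order T * 'S_#|T|) : R :=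
  (i \in position_greedy M v x setT)%:R * v (x.1 i).

Lemma greedy_value_ge0 (R : realType) (T : finType) (M : matroid T)
    (v : T -> R) (i : 'I_#|T|) (x : arrival_order T * 'S_#|T|) :
  (forall e, 0 <= v e) -> 0 <= greedy_value M v i x.
Proof. by move=> v0; apply: mulr_ge0. Qed.

Lemma greedy_value_relabel (R : realType) (T : finType) (M : matroid T)
    (v : T -> R) (t : 'S_#|T|) (i : 'I_#|T|)
    (x : arrival_order T * 'S_#|T|) :
  greedy_value M v i (relabel t x) = greedy_value M v (t i) x.
Proof.
rewrite /greedy_value mem_position_greedy_relabel ffunE; congr (_ %:R * _).
suff -> : t @: setT = setT by [].
by apply/eqP; rewrite eqEcard subsetT /= (card_imset _ (@perm_inj _ t)).
Qed.

(** Swapping two positions exchanges their shares of the optimum. *)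
Lemma sum_greedy_value (R : realType) (T : finType) (M : matroid T)
    (v : T -> R) (i j : 'I_#|T|) :
  \sum_(x | x.1 \in arrival_orders T) greedy_value M v i x =
  \sum_(x | x.1 \in arrival_orders T) greedy_value M v j x.
Proof.
rewrite (sum_relabel (tperm i j)); apply: eq_bigr => x _.
by rewrite greedy_value_relabel tpermL.
Qed.

(** * Improving positions and the counting bound *)

Definition sample (n m : nat) : {set 'I_n} := [set l : 'I_n | (l < m)%N].

Definition improving (R : realType) (T : finType) (M : matroid T) (v : T -> R)
    (m : nat) (x : arrival_order T * 'S_#|T|) (j : 'I_#|T|) : bool :=
  (m <= j)%N && (j \in position_greedy M v x (j |: sample #|T| m)).

Lemma card_sample (n m : nat) : (m <= n)%N -> #|sample n m| = m.
Proof.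
move=> mn; have wI : injective (widen_ord mn).
  by move=> a b /(congr1 val) ab; apply: val_inj.
rewrite -[RHS]card_ord -(card_imset _ wI).
apply: eq_card => l; rewrite inE; apply/idP/imsetP => [lm|[a _ ->]].
  by exists (Ordinal lm) => //; apply: val_inj.
by rewrite /= ltn_ord.
Qed.

Lemma card_sampleC (n m : nat) : (m <= n)%N -> #|~: sample n m| = (n - m)%N.
Proof. by move=> mn; rewrite cardsCs setCK card_ord card_sample. Qed.

Lemma card_sampleU1 (n m : nat) (j : 'I_n) : (m <= j)%N ->
  #|j |: sample n m| = m.+1.
Proof.
move=> mj; rewrite cardsU1 inE ltnNge mj card_sample //.
exact: leq_trans mj (ltnW (ltn_ord j)).
Qed.

(* Exchanging position [j] with any of the [m] sampled positions moves neither
   [i] nor the set of these [m + 1] positions, of which at most [rk M] are in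
   the greedy set. *)
Lemma sum_improving_le (R : realType) (T : finType) (M : matroid T)
    (v : T -> R) (m : nat) (i j : 'I_#|T|) :
  (forall e, 0 <= v e) -> (m <= i)%N -> (m <= j)%N -> j != i ->
  m.+1%:R * \sum_(x | x.1 \in arrival_orders T)
              greedy_value M v i x * (improving M v m x j)%:R <=
  (rk M)%:R * \sum_(x | x.1 \in arrival_orders T) greedy_value M v i x.
Proof.
move=> v0 mi mj ji; set Y := j |: sample #|T| m.
have H l : l \in Y ->
    \sum_(x | x.1 \in arrival_orders T)
      greedy_value M v i x * (improving M v m x j)%:R =
    \sum_(x | x.1 \in arrival_orders T)
      greedy_value M v i x * (l \in position_greedy M v x Y)%:R.
  move=> lY; symmetry; rewrite (sum_relabel (tperm l j)).
  apply: eq_bigr => x _; rewrite greedy_value_relabel tpermD //; last first.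
    apply: contraTneq lY => ->; rewrite !inE eq_sym (negbTE ji) /=.
    by rewrite -leqNgt.
  congr (_ * _%:R); rewrite mem_position_greedy_relabel tpermL /improving mj /=.
  congr (_ \in position_greedy _ _ _ _).
  apply/eqP; rewrite eqEcard (card_imset _ (@perm_inj _ _)) leqnn andbT.
  apply/subsetP => _ /imsetP[a aY ->].
  by case: tpermP => [_|_|_ _] //; rewrite !inE eqxx.
rewrite -(card_sampleU1 mj) -/Y mulr_natl -sumr_const (eq_bigr _ H).
rewrite exchange_big mulr_sumr; apply: ler_sum => x xO.
rewrite -mulr_sumr mulrC ler_wpM2r ?greedy_value_ge0 //.
rewrite -natr_sum ler_nat -big_mkcondr /= sum1dep_card.
apply: leq_trans (card_position_greedy M Y v0 xO); apply: subset_leq_card.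
by apply/subsetP => l; rewrite inE => /andP[].
Qed.

(** Later positions are counted too: the condition is free of the shortlist's history and suited to
    Markov's inequality, yet guarantees room for [i]. *)
Definition uncrowded (R : realType) (T : finType) (M : matroid T) (v : T -> R)
    (m k : nat) (x : arrival_order T * 'S_#|T|) (i : 'I_#|T|) : bool :=
  (#|[set j | (j != i) && improving M v m x j]| < k)%N.

Lemma half_greedy_value_le (R : realType) (T : finType) (M : matroid T)
    (v : T -> R) (m : nat) (i : 'I_#|T|) :
  (forall e, 0 <= v e) -> (m <= i)%N -> (2 * (#|T| - m).-1 <= m.+1)%N ->
  \sum_(x | x.1 \in arrival_orders T) greedy_value M v i x <=
  2 * \sum_(x | x.1 \in arrival_orders T)
         greedy_value M v i x * (uncrowded M v m (rk M) x i)%:R.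
Proof.
move=> v0 mi hm.
set a := \sum_(x | _) greedy_value M v i x.
(* The factor [rk M] is cancelled below, so rank 0 is settled separately: there the greedy set is
   empty. *)
have [k0|k0] := posnP (rk M).
  suff -> : a = 0.
    by rewrite mulr_ge0 // sumr_ge0 // => x _; rewrite mulr_ge0 ?greedy_value_ge0.
  apply: big1 => x xO; rewrite /greedy_value.
  have := card_position_greedy M setT v0 xO.
  by rewrite k0 leqn0 cards_eq0 => /eqP->; rewrite inE mul0r.
set L := (X in _ <= 2 * X).
pose B := \sum_(x | x.1 \in arrival_orders T)
            greedy_value M v i x * (~~ uncrowded M v m (rk M) x i)%:R.
have aLB : a = L + B.
  rewrite /a /L /B -big_split /=; apply: eq_bigr => x _; rewrite -mulrDr.
  by case: uncrowded; rewrite /= ?addr0 ?add0r mulr1.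
have a0 : 0 <= a by apply: sumr_ge0 => x _; apply: greedy_value_ge0.
pose J := [set j : 'I_#|T| | (m <= j)%N && (j != i)].
have cJ : #|J| = (#|T| - m).-1.
  have mT : (m <= #|T|)%N by apply: leq_trans mi (ltnW (ltn_ord i)).
  rewrite -(card_sampleC mT) (cardsD1 i (~: _)) !inE -leqNgt mi /=.
  apply: eq_card => j.
  by rewrite !inE -leqNgt andbC.
(* Markov's inequality weighted by [greedy_value]: a crowded outcome has at least [rk M] improving
   positions in [J]. *)
have kB : (rk M)%:R * B <= \sum_(j in J)
    \sum_(x | x.1 \in arrival_orders T)
      greedy_value M v i x * (improving M v m x j)%:R.
  rewrite exchange_big mulr_sumr; apply: ler_sum => x xO.
  rewrite -mulr_sumr mulrCA ler_wpM2l ?greedy_value_ge0 //.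
  rewrite -natr_sum -natrM ler_nat -big_mkcondr /= sum1dep_card.
  rewrite /uncrowded -leqNgt; case: (leqP (rk M) _); rewrite ?muln0 ?muln1 //.
  move/leq_trans; apply; apply: subset_leq_card; apply/subsetP => j.
  by rewrite !inE => /andP[ji impj]; rewrite ji impj; case/andP: impj => ->.
have mkB : m.+1%:R * ((rk M)%:R * B) <= (#|T| - m).-1%:R * ((rk M)%:R * a).
  apply: le_trans (ler_wpM2l (ler0n _ _) kB) _.
  rewrite mulr_sumr -cJ (mulr_natl _ #|J|) -sumr_const; apply: ler_sum => j.
  by rewrite inE => /andP[mj ji]; apply: sum_improving_le.
have mB : m.+1%:R * B <= (#|T| - m).-1%:R * a.
  by move: mkB; rewrite mulrCA (mulrCA _ (rk M)%:R) ler_pM2l // ltr0n.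
(* The hypothesis on [m] makes the crowded part at most half of the total. *)
have B2 : 2 * B <= a.
  rewrite -(ler_pM2l (ltr0Sn R m)) mulrCA; apply: le_trans (ler_wpM2l _ mB) _ => //.
  by rewrite mulrA -natrM ler_wpM2r // ler_nat.
by move: B2; rewrite aLB; lra.
Qed.

(** The factor 6 is 3 times 2: at least a third of the positions follow the sample, and at least
    half of the share of each of them is uncrowded. *)
Lemma OPT_le_uncrowded (R : realType) (T : finType) (M : matroid T)
    (v : T -> R) (m : nat) :
  (forall e, 0 <= v e) -> (2 * (#|T| - m).-1 <= m.+1)%N ->
  (#|T| <= 3 * (#|T| - m))%N ->
  \sum_(x : arrival_order T * 'S_#|T| | x.1 \in arrival_orders T) OPT M v <=
  6 * \sum_(x | x.1 \in arrival_orders T)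
        \sum_(i : 'I_#|T| | (m <= i)%N && uncrowded M v m (rk M) x i)
           greedy_value M v i x.
Proof.
move=> v0 hm hT.
have lhs : \sum_(x : arrival_order T * 'S_#|T| | x.1 \in arrival_orders T) OPT M v
    <= \sum_i \sum_(x | x.1 \in arrival_orders T) greedy_value M v i x.
  rewrite exchange_big; apply: ler_sum => x xO.
  apply: le_trans (OPT_le_position_greedy M v0 xO) _; rewrite big_mkcond.
  apply: ler_sum => i _; rewrite /greedy_value.
  by case: (_ \in _); rewrite ?mul1r ?mul0r.
apply: le_trans lhs _.
have -> : \sum_(x | x.1 \in arrival_orders T)
        \sum_(i : 'I_#|T| | (m <= i)%N && uncrowded M v m (rk M) x i)
           greedy_value M v i x =
   \sum_(i : 'I_#|T| | (m <= i)%N) \sum_(x | x.1 \in arrival_orders T)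
         greedy_value M v i x * (uncrowded M v m (rk M) x i)%:R.
  rewrite exchange_big; apply: eq_bigr => x _; rewrite big_mkcondr.
  by apply: eq_bigr => i _; case: uncrowded; rewrite ?mulr1 ?mulr0.
(* A position [i0] is needed to name the common share; without positions the left side is an empty
   sum. *)
have [i0 _|noi] := pickP 'I_#|T|; last first.
  rewrite big_pred0 => [|i]; last by have := noi i.
  rewrite mulr_ge0 // sumr_ge0 // => i _; rewrite sumr_ge0 // => x _.
  by rewrite mulr_ge0 // greedy_value_ge0.
set a := \sum_(x | x.1 \in arrival_orders T) greedy_value M v i0 x.
have a0 : 0 <= a by apply: sumr_ge0 => x _; apply: greedy_value_ge0.
rewrite (eq_bigr (fun=> a)) => [|i _]; last exact: sum_greedy_value.
have mT : (m <= #|T|)%N by have := ltn_ord i0; lia.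
have sum_a : \sum_(i : 'I_#|T| | (m <= i)%N) a = (#|T| - m)%:R * a.
  rewrite -(card_sampleC mT) mulr_natl -sumr_const; apply: eq_bigl => i.
  by rewrite !inE -leqNgt.
rewrite sumr_const card_ord -(mulr_natl a).
apply: (@le_trans _ _ (3 * \sum_(i : 'I_#|T| | (m <= i)%N) a)).
  by rewrite sum_a mulrA -natrM ler_wpM2r // ler_nat.
have -> : (6 : R) = 3 * 2 by rewrite -natrM.
rewrite -mulrA ler_wpM2l // mulr_sumr; apply: ler_sum => i mi.
by rewrite /a (sum_greedy_value M v i0 i); apply: half_greedy_value_le.
Qed.

(** * Random seeds and expectations *)

Definition uniform_below (R : realType) (N : nat) : set nat -> \bar R :=
  mscale (N.+1%:R^-1)%:nng (msum (fun k => \d_k) N.+1).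

HB.instance Definition _ (R : realType) (N : nat) :=
  Measure.on (@uniform_below R N).

Lemma uniform_below_setT (R : realType) (N : nat) :
  @uniform_below R N [set: nat]%classic = 1%E.
Proof.
rewrite /uniform_below /mscale /= /msum.
rewrite (eq_bigr (fun=> 1%:E)) => [|k _]; last by rewrite /= diracE mem_set.
by rewrite sumEFin -EFinM sumr_const card_ord mulVf // pnatr_eq0.
Qed.

HB.instance Definition _ (R : realType) (N : nat) :=
  Measure_isProbability.Build _ _ _ (@uniform_below R N)
    (@uniform_below_setT R N).

Lemma expectation_uniform_below (R : realType) (N : nat) (f : nat -> R) :
  (forall w, 0 <= f w) ->
  ('E_(@uniform_below R N)[f] = (N.+1%:R^-1 * \sum_(w < N.+1) f w)%:E)%E.
Proof.
move=> f0; rewrite unlock /uniform_below.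
rewrite ge0_integral_mscale //= => [|w _]; last by rewrite lee_fin.
rewrite ge0_integral_measure_sum //= => [|w _]; last by rewrite lee_fin.
rewrite EFinM -sumEFin; congr (_ * _)%E; apply: eq_bigr => w _.
by rewrite integral_dirac // diracT mul1e.
Qed.

(** The default is met only from [#|'S_n|] on, where [uniform_below] with [N = #|'S_n|.-1] puts no
    mass. *)
Definition seed_perm (n w : nat) : 'S_n := nth 1%g (enum 'S_n) w.

(** Seeds are natural numbers because every set of them is measurable, which settles
    [decide_measurable]. *)
Definition uniform_algorithm (R : realType) (D : finType) (n : nat)
    (dec : 'S_n -> 'I_n -> observation R n -> {set 'I_n} -> D) :
    online_algorithm R D n :=
  @OnlineAlgorithm R D n _ nat (@uniform_below R #|'S_n|.-1)
    (fun w => dec (seed_perm n w)) (fun _ _ _ _ => I).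

Lemma arrival_orders_gt0 (T : finType) : (0 < #|arrival_orders T|)%N.
Proof.
apply/card_gt0P; exists [ffun i => enum_val i]; rewrite inE.
by apply/injectiveP => i j; rewrite !ffunE => /enum_val_inj.
Qed.

(** The passage from finite sums over pairs to expectations: the last hypothesis compares averages
    with their common denominator cleared. *)
Lemma expected_payoff_ge (R : realType) (T D : finType)
    (dec : 'S_#|T| -> 'I_#|T| -> observation R #|T| -> {set 'I_#|T|} -> D)
    (payoff : arrival_order T -> nat -> R)
    (F : arrival_order T * 'S_#|T| -> R) (C : R) :
  (forall x, 0 <= F x) ->
  (forall s w, s \in arrival_orders T ->
     F (s, seed_perm _ w) <= payoff s w) ->
  \sum_(x : arrival_order T * 'S_#|T| | x.1 \in arrival_orders T) C <=
    \sum_(x | x.1 \in arrival_orders T) F x ->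
  (C%:E <= @expected_payoff R T D (uniform_algorithm dec) payoff)%E.
Proof.
move=> F0 Fp; set Ord := arrival_orders T.
have pairE (G : arrival_order T * 'S_#|T| -> R) :
    \sum_(x | x.1 \in Ord) G x = \sum_(p : 'S_#|T|) \sum_(s in Ord) G (s, p).
  rewrite exchange_big pair_big /=; apply: eq_big => [x|[s p] _] //.
  by rewrite andbT.
rewrite !pairE sumr_const sumr_const => CF.
have SE : #|'S_(#|T|)|.-1.+1 = #|'S_(#|T|)|.
  by rewrite prednK //; apply/card_gt0P; exists 1%g.
pose G w := (#|Ord|%:R)^-1 * \sum_(s in Ord) F (s, seed_perm _ w).
have G0 w : 0 <= G w by rewrite /G mulr_ge0 ?invr_ge0 ?sumr_ge0.
have EG : ('E_(@uniform_below R #|'S_(#|T|)|.-1)[G] <=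
    @expected_payoff R T D (uniform_algorithm dec) payoff)%E.
  rewrite /expected_payoff unlock; apply: ge0_le_integral => //=.
  - by move=> w _; rewrite lee_fin.
  - move=> w _; rewrite lee_fin ler_wpM2l ?invr_ge0 //; apply: ler_sum => s sO.
    exact: Fp.
apply: le_trans EG; rewrite expectation_uniform_below // lee_fin SE.
have -> : \sum_(w < #|'S_(#|T|)|) G w =
    (#|Ord|%:R)^-1 * \sum_(p : 'S_#|T|) \sum_(s in Ord) F (s, p).
  rewrite -mulr_sumr; congr (_ * _).
  transitivity (\sum_(p <- enum 'S_(#|T|)) \sum_(s in Ord) F (s, p)).
    by rewrite (big_nth 1%g) big_mkord -cardE.
  by rewrite big_enum.
have Op : 0 < #|Ord|%:R :> R by rewrite ltr0n arrival_orders_gt0.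
have Sp : 0 < #|'S_(#|T|)|%:R :> R by rewrite ltr0n -SE.
rewrite -(ler_pM2l Op) -(ler_pM2l Sp).
rewrite (mulrCA #|Ord|%:R _^-1) !mulVKf ?gt_eqF // !mulr_natl.
by rewrite (eq_card (B := 'S_(#|T|))) in CF.
Qed.

(** * Runs on partial information *)

(** At time [i] the positions up to [i], that is [sample #|T| i.+1], are revealed, so these greedy
    sets can be computed online. *)
Lemma greedy_observe (R : realType) (T : finType) (M : matroid T)
    (v : T -> R) (s : arrival_order T) (p : 'S_#|T|) (i : 'I_#|T|)
    (X : {set 'I_#|T|}) :
  X \subset sample #|T| i.+1 ->
  greedy (obs_indep (observe M v s i))
    (before (fun j => obs_value (observe M v s i) j) (fun j => p j)) X =
  position_greedy M v (s, p) X.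
Proof.
move=> sX; apply: eq_greedy => [B BX|a b aX bX].
  rewrite !inE; suff -> : B \subset [set j : 'I_#|T| | (j <= i)%N] by [].
  exact: subset_trans BX sX.
have le_i x : x \in X -> (x <= i)%N by move/(subsetP sX); rewrite inE.
by rewrite /before /= !ffunE !le_i.
Qed.

Lemma selectedS (R : realType) (T : finType) (D : finType)
    (update : 'I_#|T| -> {set 'I_#|T|} -> D -> {set 'I_#|T|})
    (a : online_algorithm R D #|T|) (M : matroid T) (v : T -> R)
    (s : arrival_order T) (w : seed a) (i : 'I_#|T|) :
  selected update M v s w i.+1 =
  update i (selected update M v s w i)
    (decide w i (observe M v s i) (selected update M v s w i)).
Proof.
rewrite /selected (take_nth i) ?size_enum_ord // foldl_rcons.
by rewrite nth_ord_enum.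
Qed.

Lemma selected_oversize (R : realType) (T : finType) (D : finType)
    (update : 'I_#|T| -> {set 'I_#|T|} -> D -> {set 'I_#|T|})
    (a : online_algorithm R D #|T|) (M : matroid T) (v : T -> R)
    (s : arrival_order T) (w : seed a) (t : nat) : (#|T| <= t)%N ->
  selected update M v s w t.+1 = selected update M v s w t.
Proof.
by move=> Tt; rewrite /selected !take_oversize ?size_enum_ord // (leq_trans Tt).
Qed.

(** * The preemption algorithm *)

Definition greedy_preemption (R : realType) (n k : nat) :
    preemption_algorithm R n :=
  uniform_algorithm (fun p i o _ =>
    greedy (obs_indep o) (before (fun j => obs_value o j) (fun j => p j))
      (sample n i.+1)).

Lemma sampleS (n m m' : nat) : (m <= m')%N -> sample n m \subset sample n m'.
Proof. by move=> mm; apply/subsetP => j; rewrite !inE => /leq_trans; apply. Qed.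

Lemma sample_full (n : nat) : sample n n = setT.
Proof. by apply/setP => j; rewrite !inE ltn_ord. Qed.

(** A greedy position older than [t] was already greedy before [t] arrived, by [greedyS], so the
    intersection in [hold] loses nothing. *)
Lemma selected_greedy (R : realType) (T : finType) (M : matroid T)
    (v : T -> R) (s : arrival_order T) (k : nat)
    (w : seed (greedy_preemption R #|T| k)) (t : nat) :
  selected (@hold #|T|) M v s w t =
  position_greedy M v (s, seed_perm _ w) (sample #|T| t).
Proof.
elim: t => [|t IH].
  rewrite /selected take0 /=; symmetry; apply/eqP; rewrite -subset0.
  by apply: subset_trans (greedy_sub _ _ _) _; apply/subsetP => j; rewrite inE.
have [tT|Tt] := ltnP t #|T|; last first.
  rewrite selected_oversize // IH; congr (position_greedy _ _ _ _).
  by apply/setP => j; rewrite !inE !(leq_trans (ltn_ord j)) // (leq_trans Tt).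
rewrite (selectedS _ _ _ _ _ (Ordinal tT)) IH /hold.
rewrite (_ : decide _ _ _ _ =
  position_greedy M v (s, seed_perm _ w) (sample #|T| t.+1)); last first.
  exact: greedy_observe.
apply/setIidPl/subsetP => x xG; rewrite in_setU1.
have [//|xi] := eqVneq x (Ordinal tT).
apply: (subsetP (greedyS _ _ (sampleS _ (leqnSn t)))); rewrite inE xG andbT.
have := subsetP (greedy_sub _ _ _) _ xG; rewrite !inE ltnS leq_eqVlt.
by case/orP => // /eqP xt; case/eqP: xi; apply: val_inj.
Qed.

(* A third of the arrivals, rounded so that [3 * (n - m) >= n] and
   [2 * (n - m - 1) <= m + 1] both hold, remains after the sample. *)
Definition sample_size (n : nat) : nat := (n - (n %/ 3).+1)%N.

(** * The shortlist algorithm *)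

Definition greedy_shortlist (R : realType) (n k : nat) :
    shortlist_algorithm R n :=
  uniform_algorithm (fun p i o A =>
    [&& (sample_size n <= i)%N, (#|A| < k)%N &
      i \in greedy (obs_indep o)
        (before (fun j => obs_value o j) (fun j => p j))
        (i |: sample n (sample_size n))]).

Lemma enlist_decideE (R : realType) (T : finType) (M : matroid T)
    (v : T -> R) (s : arrival_order T) (k : nat)
    (w : seed (greedy_shortlist R #|T| k)) (i : 'I_#|T|) (A : {set 'I_#|T|}) :
  decide w i (observe M v s i) A =
  (#|A| < k)%N &&
  improving M v (sample_size #|T|) (s, seed_perm _ w) i.
Proof.
rewrite /= /improving; set m := sample_size _.
have [mi|] := leqP m i; last by rewrite andbF.
rewrite greedy_observe // subUset sub1set inE leqnn /=.
exact: sampleS (leq_trans mi (leqnSn i)).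
Qed.

Lemma card_enlisted (R : realType) (T : finType) (M : matroid T)
    (v : T -> R) (s : arrival_order T) (k : nat)
    (w : seed (greedy_shortlist R #|T| k)) (t : nat) :
  (#|selected (@enlist #|T|) M v s w t| <= k)%N.
Proof.
elim: t => [|t IH]; first by rewrite /selected take0 cards0.
have [tT|Tt] := ltnP t #|T|; last by rewrite selected_oversize.
rewrite (selectedS _ _ _ _ _ (Ordinal tT)) enlist_decideE /enlist.
case: ifP => // /andP[Ak _]; rewrite cardsU1.
by apply: leq_trans Ak; rewrite -add1n leq_add2r leq_b1.
Qed.

Lemma enlisted_improving (R : realType) (T : finType) (M : matroid T)
    (v : T -> R) (s : arrival_order T) (k : nat)
    (w : seed (greedy_shortlist R #|T| k)) (t : nat) (j : 'I_#|T|) :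
  j \in selected (@enlist #|T|) M v s w t ->
  (j < t)%N /\
  improving M v (sample_size #|T|) (s, seed_perm _ w) j.
Proof.
elim: t => [|t IH]; first by rewrite /selected take0 inE.
have [tT|Tt] := ltnP t #|T|; last first.
  by rewrite selected_oversize // => /IH[jt ->]; rewrite ltnW.
rewrite (selectedS _ _ _ _ _ (Ordinal tT)) enlist_decideE /enlist.
have old : j \in selected (@enlist #|T|) M v s w t -> (j < t.+1)%N /\
    improving M v (sample_size #|T|) (s, seed_perm _ w) j.
  by move=> /IH[jt ->]; rewrite ltnW.
by case: ifP => // /andP[_ imp]; rewrite in_setU1 => /orP[/eqP->|].
Qed.

Lemma enlisted_mono (R : realType) (T : finType) (M : matroid T)
    (v : T -> R) (s : arrival_order T) (k : nat)
    (w : seed (greedy_shortlist R #|T| k)) (t t' : nat) : (t <= t')%N ->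
  selected (@enlist #|T|) M v s w t \subset
  selected (@enlist #|T|) M v s w t'.
Proof.
move=> /subnKC <-; elim: (t' - t)%N => [|d IH]; first by rewrite addn0.
rewrite addnS; apply: subset_trans IH _.
have [tT|Tt] := ltnP (t + d) #|T|; last by rewrite selected_oversize.
rewrite (selectedS _ _ _ _ _ (Ordinal tT)) /enlist.
by case: ifP => // _; apply: subsetUr.
Qed.

(** All positions listed before [i] arrives are improving and differ from [i], so there are fewer
    than [k] of them and [i] still fits. *)
Lemma uncrowded_enlisted (R : realType) (T : finType) (M : matroid T)
    (v : T -> R) (s : arrival_order T) (k : nat)
    (w : seed (greedy_shortlist R #|T| k)) (i : 'I_#|T|) :
  uncrowded M v (sample_size #|T|) k (s, seed_perm _ w) i ->
  improving M v (sample_size #|T|) (s, seed_perm _ w) i ->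
  i \in selected (@enlist #|T|) M v s w #|T|.
Proof.
(* The selection after [i.+1] arrivals is the first to include the decision on [i], and nothing is
   removed afterwards. *)
move=> unc imp; apply: (subsetP (enlisted_mono M v s w (ltn_ord i))).
rewrite selectedS enlist_decideE imp andbT /enlist.
rewrite (leq_ltn_trans _ unc) ?setU11 //; apply: subset_leq_card.
apply/subsetP => j /enlisted_improving[ji jimp]; rewrite inE jimp andbT.
by apply: contraTneq ji => ->; rewrite ltnn.
Qed.

Lemma weight_imset (R : realType) (T : finType) (v : T -> R)
    (s : arrival_order T) (A : {set 'I_#|T|}) : s \in arrival_orders T ->
  weight v (s @: A) = \sum_(i in A) v (s i).
Proof.
move=> /arrival_order_inj sI; rewrite /weight big_imset // => ? ? _ _.
exact: sI.
Qed.

Lemma uncrowded_le_best_in (R : realType) (T : finType) (M : matroid T)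
    (v : T -> R) (s : arrival_order T)
    (w : seed (greedy_shortlist R #|T| (rk M))) :
  (forall e, 0 <= v e) -> s \in arrival_orders T ->
  \sum_(i : 'I_#|T| | (sample_size #|T| <= i)%N &&
         uncrowded M v (sample_size #|T|) (rk M) (s, seed_perm _ w) i)
     greedy_value M v i (s, seed_perm _ w) <=
  best_in M v (shortlist M v s w #|T|).
Proof.
move=> v0 sO; set x := (s, seed_perm _ w).
pose G := position_greedy M v x setT.
pose A := selected (@enlist #|T|) M v s w #|T|.
(* The witness is the listed part of the optimal greedy set, independent as a subset of it. *)
apply: (@le_trans _ _ (weight v (s @: (G :&: A)))); last first.
  apply: (le_bigmax_cond _ (fun S : {set T} => weight v S)).
  rewrite imsetS ?subsetIr // andbT.
  apply: indep_sub (@position_greedy_indep _ _ M _ x setT v0 sO).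
  by rewrite imsetS // subsetIl.
rewrite weight_imset // big_mkcond [leRHS]big_mkcond; apply: ler_sum => i _.
rewrite /greedy_value -/G in_setI.
case: ifPn => [/andP[mi unc]|_]; last by case: ifP.
have [iG|] /= := boolP (i \in G); last by rewrite mul0r.
rewrite mul1r (_ : i \in A) //; apply: uncrowded_enlisted unc _.
(* A position greedy among all positions stays greedy among the sample and itself. *)
rewrite /improving mi /=; apply: (subsetP (greedyS _ _ (subsetT _))).
by rewrite in_setI setU11.
Qed.

Lemma OPT_ge0 (R : realType) (T : finType) (M : matroid T) (v : T -> R) :
  0 <= OPT M v.
Proof. exact: bigmax_ge_id. Qed.

Theorem theorem2 (R : realType) :
  exists c : R, 0 < c /\
    (exists alg : forall n k : nat, preemption_algorithm R n,
       preemption_always_independent alg /\ preemption_competitive c alg) /\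
    (exists alg : forall n k : nat, shortlist_algorithm R n,
       shortlist_size_at_most (fun k => k) alg /\ shortlist_competitive c alg).
Proof.
(* The shortlist bound dictates the constant; the preemption algorithm attains the optimum
   itself. *)
exists 6^-1; split; first by rewrite invr_gt0.
split.
  exists (greedy_preemption R); split=> T M v v0.
    move=> s sO w t; rewrite /held selected_greedy.
    exact: (@position_greedy_indep _ _ M _ (s, _) _ v0 sO).
  apply: (@expected_payoff_ge _ _ _ _ _
    (fun x => \sum_(i in position_greedy M v x setT) v (x.1 i))).
  - by move=> x; apply: sumr_ge0.
  - by move=> s w sO; rewrite /held selected_greedy sample_full weight_imset.
  - apply: ler_sum => x xO; apply: le_trans (OPT_le_position_greedy M v0 xO).
    by rewrite ler_piMl ?OPT_ge0 // invf_le1 // ler1n.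
exists (greedy_shortlist R); split=> T M v v0.
  move=> s sO w; rewrite /shortlist; apply: leq_trans (leq_imset_card _ _) _.
  exact: card_enlisted.
apply: (@expected_payoff_ge _ _ _ _ _
  (fun x => \sum_(i : 'I_#|T| | (sample_size #|T| <= i)%N &&
                uncrowded M v (sample_size #|T|) (rk M) x i)
              greedy_value M v i x)).
- by move=> x; apply: sumr_ge0 => i _; apply: greedy_value_ge0.
- by move=> s w sO; apply: uncrowded_le_best_in.
- rewrite -mulr_sumr ler_pdivrMl //.
  by apply: OPT_le_uncrowded => //; rewrite /sample_size; lia.
Qed.
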